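(* Let $(\Omega,\mathcal{F})$ be a measurable space, let $\mathcal{P}$ be the set of all probability measures on $(\Omega,\mathcal{F})$, let $q\in\mathcal{P}$, and let $\mathcal{P}_q=\{p\in\mathcal{P}\mid p\ll q\}$. The extreme points of $\mathcal{P}_q$ are precisely the measures $q_A$, where $A$ ranges over all $q$-atoms. In particular, $\mathcal{P}_q$ has no extreme points if $q$ is atomless.
   Context: We write $p\ll q$ for absolute continuity. A set $A\in\mathcal{F}$ is a $q$-atom if $q(A)>0$ and every $B\in\mathcal{F}$ with $B\subseteq A$ satisfies $q(B)\in\{0,q(A)\}$; $q$ is atomless if there are no $q$-atoms. For a $q$-atom $A$, $q_A$ is the probability measure $q_A(B):=\frac{q(A\cap B)}{q(A)}$, $B\in\mathcal{F}$. An extreme point of a convex set $\mathcal{C}$ of probability measures is a $p\in\mathcal{C}$ such that $p=\lambda p'+(1-\lambda)p''$ with $p',p''\in\mathcal{C}$ and $\lambda\in(0,1)$ implies $p'=p''=p$. *)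

(* Defs.v *)
From HB Require Import structures.
From mathcomp Require Import all_boot all_order all_algebra.
From mathcomp Require Import all_classical all_reals all_analysis.
From mathcomp Require Import giry.

Set Implicit Arguments.
Unset Strict Implicit.
Unset Printing Implicit Defensive.
Import Order.TTheory GRing.Theory Num.Theory.
Import numFieldNormedType.Exports.

Local Open Scope classical_set_scope.
Local Open Scope ring_scope.
Local Open Scope ereal_scope.

Definition is_atom d (T : measurableType d) (R : realType)
    (q : probability T R) (A : set T) : Prop :=
  [/\ measurable A, 0 < q A &
      forall B, measurable B -> B `<=` A -> q B = 0 \/ q B = q A].

Definition atomless d (T : measurableType d) (R : realType)
    (q : probability T R) : Prop :=
  forall A, ~ is_atom q A.

(* The proof argument makes q_A a term of type probability T R. *)
Definition atom_probability d (T : measurableType d) (R : realType)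
    (q : probability T R) (A : set T) (atomA : is_atom q A)
    (B : set T) : \bar R :=
  q (A `&` B) / q A.

Section atom_probability_instance.
Context d (T : measurableType d) (R : realType).
Variables (q : probability T R) (A : set T) (atomA : is_atom q A).

Let mA : measurable A. Proof. by case: atomA. Qed.

Let qA_neq0 : q A != 0. Proof. by case: atomA => _ qA0 _; rewrite gt_eqF. Qed.

Let qA_fin : q A \is a fin_num. Proof. exact: fin_num_measure. Qed.

Let qAV_fin : (q A)^-1 \is a fin_num.
Proof. by rewrite fin_numV//; case/fin_numPlt/andP: qA_fin => /gt_eqF->. Qed.

Let atom_probability0 : atom_probability atomA set0 = 0.
Proof. by rewrite /atom_probability setI0 measure0 mul0e. Qed.

Let atom_probability_ge0 B : 0 <= atom_probability atomA B.
Proof. by rewrite /atom_probability mule_ge0// inve_ge0. Qed.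

Let atom_probability_sigma_additive :
  semi_sigma_additive (atom_probability atomA).
Proof.
move=> F mF tF mUF; rewrite /atom_probability.
rewrite [X in X @ _ --> _](_ : _ =
    (fun n => (\sum_(0 <= i < n) q (A `&` F i)) * (q A)^-1)); last first.
  by apply/funext => n; rewrite ge0_sume_distrl.
apply: cvgeZr => //; rewrite setI_bigcupr.
apply: measure_semi_sigma_additive.
- by move=> n; exact: measurableI.
- exact: trivIset_setIl.
- by rewrite -setI_bigcupr; exact: measurableI.
Qed.

HB.instance Definition _ := isMeasure.Build _ _ _ (atom_probability atomA)
  atom_probability0 atom_probability_ge0 atom_probability_sigma_additive.

Let atom_probability_setT : atom_probability atomA setT = 1.
Proof. by rewrite /atom_probability setIT divee. Qed.

HB.instance Definition _ := Measure_isProbability.Build _ _ _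
  (atom_probability atomA) atom_probability_setT.

End atom_probability_instance.

Definition dominated_probabilities d (T : measurableType d) (R : realType)
    (q : probability T R) : set (probability T R) :=
  [set p : probability T R | p `<< q].

(* Measures are total functions on set T whose values on non-measurable sets
   are only required to be nonnegative, so equality of measures on the
   sigma-algebra is measure_eq (agreement on the measurable sets), not Leibniz
   equality. The identity p = l p' + (1 - l) p'' is likewise required on the
   measurable sets only. *)
Definition extreme_points d (T : measurableType d) (R : realType)
    (C : set (probability T R)) : set (probability T R) :=
  [set p : probability T R | C p /\
    forall (p' p'' : probability T R) (l : R),
      C p' -> C p'' -> (0 < l < 1)%R ->
      (forall B, measurable B ->
        p B = l%:E * p' B + (1 - l)%:E * p'' B) ->
      measure_eq p' p /\ measure_eq p'' p].

(* Main.v *)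
Require Import Defs.
From mathcomp Require Import all_boot all_order all_algebra.
From mathcomp Require Import all_classical all_reals all_analysis.
From mathcomp Require Import giry.

(** The two sides are linked by zero-one measures, which take only the values 0
    and 1 on measurable sets.

    If [p << q] is extreme, then [p] is zero-one ([extreme_zero_one]): a set
    [B] with [0 < p B < 1] would write [p] as the mixture, with weights [p B]
    and [1 - p B], of its conditionings on [B] and on the complement of [B],
    and the first of these differs from [p] since it gives mass 1 to [B].

    If [p << q] is zero-one, then [p] is some [q_A]
    ([zero_one_dominated_atom]).  Take for [A] a set of full [p]-measure whose
    [q]-measure is least among such sets; it exists because countable
    intersections preserve full measure ([exists_least_full_set]).  Of the two
    pieces into which a measurable [B] cuts [A], one has full [p]-measure, and
    by minimality it carries all the [q]-mass of [A]; so [A] is an atom.  As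
    [p] lives on [A] and [p << q], it is dominated by [q_A], hence equal to it
    by the rigidity below.

    Conversely, [q_A] is zero-one and dominated by [q] ([atom_zero_one],
    [atom_dominated]), and a zero-one measure is extreme in every set of
    probabilities that contains it ([zero_one_extreme]), because the components
    of a proper mixture are dominated by the mixture.

    The rigidity behind both directions is [zero_one_dominated_eq]: a zero-one
    probability dominates no probability other than itself. *)

Set Implicit Arguments.
Unset Strict Implicit.
Unset Printing Implicit Defensive.
Import Order.TTheory GRing.Theory Num.Theory.

Local Open Scope classical_set_scope.
Local Open Scope ereal_scope.

Section zero_one.
Context d (T : measurableType d) (R : realType).
Implicit Types (p q : probability T R) (A B : set T).

Definition zero_one p := forall B, measurable B -> p B = 0 \/ p B = 1.

Lemma probability_setC_eq0 p B : measurable B -> p (~` B) = 0 <-> p B = 1.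
Proof.
move=> mB; rewrite probability_setC//.
have /fineK <- : p B \is a fin_num by exact: fin_num_measure.
rewrite -EFinB; split=> [[/eqP]|[->]]; last by rewrite subrr.
by rewrite subr_eq0 => /eqP <-.
Qed.

(** A set of full measure for the dominating probability has a null complement,
    hence full measure for the dominated one as well. *)
Lemma zero_one_dominated_eq p q : zero_one p -> q `<< p -> measure_eq q p.
Proof.
move=> p01 /null_content_dominatesP qp B mB; change (q B = p B).
have [pB0|pB1] := p01 _ mB; first by rewrite pB0 qp.
rewrite pB1; apply/probability_setC_eq0 => //; apply: qp.
  exact: measurableC.
exact/probability_setC_eq0.
Qed.

(** With weights [l] and [1 - l] both positive, a null set of the mixture is
    null for each component, so each component is dominated by the mixture. *)
Lemma zero_one_extreme (C : set (probability T R)) p :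
  C p -> zero_one p -> extreme_points C p.
Proof.
move=> Cp p01; split=> // p' p'' l _ _ /andP[l0 l1] pE.
have l'0 : (0 < 1 - l)%R by rewrite subr_gt0.
suff H B : measurable B -> p B = 0 -> p' B = 0 /\ p'' B = 0.
  by split; apply: zero_one_dominated_eq => //;
    apply/null_content_dominatesP => B mB /(H _ mB) [].
move=> mB; rewrite pE// => /eqP.
rewrite padde_eq0 ?mule_ge0 ?measure_ge0 ?lee_fin ?(ltW l0) ?(ltW l'0)//.
by rewrite !mule_eq0 !eqe (gt_eqF l0) (gt_eqF l'0) => /andP[/eqP -> /eqP ->].
Qed.

(** Normalizing fails when [p B = 0]; the value is then [p] itself, so that the
    result is a probability for every measurable [B]. *)
Definition conditioned p B (mB : measurable B) : probability T R :=
  mnormalize (mrestr p mB) p.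

Lemma conditionedE p B (mB : measurable B) C : p B != 0 ->
  conditioned p mB C = p (C `&` B) * (fine (p B))^-1%:E.
Proof.
move=> pB0; have pBy : p B != +oo.
  by rewrite lt_eqF// (le_lt_trans (probability_le1 p mB))// ltry.
rewrite /conditioned /= /mnormalize /= /mrestr setTI.
by rewrite (negbTE pB0) (negbTE pBy).
Qed.

Lemma conditioned_dominated p q B (mB : measurable B) : p B != 0 ->
  p `<< q -> conditioned p mB `<< q.
Proof.
move=> pB0 /null_content_dominatesP pq.
apply/null_content_dominatesP => C mC qC0.
rewrite conditionedE//; suff -> : p (C `&` B) = 0 by rewrite mul0e.
apply: (subset_measure0 _ mC) => //; last exact: pq.
exact: measurableI.
Qed.

(** Conditioning stays inside the set of probabilities dominated by [q], which
    is what makes the decomposition of [p] along [B] and its complement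
    admissible; extremality then equates [p] with its conditioning on [B], whose
    value at [B] is 1. *)
Lemma extreme_zero_one p q :
  extreme_points (dominated_probabilities q) p -> zero_one p.
Proof.
move=> [pq pext] B mB.
have [->|pB0] := eqVneq (p B) 0; first by left.
have [->|pB1] := eqVneq (p B) 1; first by right.
have mCB : measurable (~` B) by exact: measurableC.
have pCB0 : p (~` B) != 0.
  by apply/eqP => /(probability_setC_eq0 p mB)/eqP; exact/negP.
have pBfin : p B \is a fin_num by exact: fin_num_measure.
have pCBE : p (~` B) = (1 - fine (p B))%:E.
  by rewrite probability_setC// -{1}(fineK pBfin).
have l0 : fine (p B) != 0%R by rewrite -eqe fineK.
have l'0 : (1 - fine (p B) != 0)%R by rewrite -eqe -pCBE.
have l01 : (0 < fine (p B) < 1)%R.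
  rewrite lt_neqAle eq_sym l0 fine_ge0//= lt_neqAle -lee_fin -eqe fineK//.
  by rewrite pB1 probability_le1.
have [] := pext (conditioned p mB) (conditioned p mCB) _ _ _ l01.
- exact: conditioned_dominated.
- exact: conditioned_dominated.
- (* the weights cancel the normalizing factors of the conditionings *)
  move=> C mC; rewrite !conditionedE// pCBE/= (measureDI p mC mB) setDE.
  rewrite !muleA ![_%:E * p _]muleC -!muleA -!EFinM !divff// !mule1.
  by rewrite addeC.
move=> pE _; right; have <- : conditioned p mB B = p B by exact: pE.
by rewrite conditionedE// setIid -{1}(fineK pBfin) -EFinM divff.
Qed.

(** The intersection of a sequence of sets of full [p]-measure whose
    [q]-measures tend to the infimum still has full [p]-measure, and its
    [q]-measure is at most each term of the sequence, hence at most the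
    infimum. *)
Lemma exists_least_full_set p q : exists A, [/\ measurable A, p A = 1 &
  forall B, measurable B -> p B = 1 -> q A <= q B].
Proof.
pose full := [set B | measurable B /\ p B = 1].
have /ereal_inf_seq[u u_full u_inf] : q @` full != set0.
  apply/set0P; exists (q setT), setT => //.
  by split=> //; exact: probability_setT.
have /choice[F FP] n : exists B, full B /\ q B = u n.
  by have [B fB <-] := u_full n; exists B.
have mF n : measurable (F n) by have [[]] := FP n.
have mI : measurable (\bigcap_n F n) by exact: bigcapT_measurable.
exists (\bigcap_n F n); split=> //.
  apply/probability_setC_eq0 => //; rewrite setC_bigcap.
  apply/negligibleP; first by apply: bigcupT_measurable => n; exact: measurableC.
  apply: negligible_bigcup => n; apply/negligibleP; first exact: measurableC.
  by apply/probability_setC_eq0 => //; have [[]] := FP n.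
move=> B mB pB1; apply: (@le_trans _ _ (ereal_inf (q @` full))); last first.
  by apply: ereal_inf_lbound; exists B.
apply: cvge_ge u_inf; apply: nearW => n; have [_ <-] := FP n.
by rewrite le_measure ?inE//; exact: bigcap_inf.
Qed.

Lemma atom_zero_one q A (atomA : is_atom q A) :
  zero_one (atom_probability atomA).
Proof.
have [mA qA0 atomP] := atomA; move=> B mB.
rewrite /= /atom_probability.
have [->|->] := atomP (A `&` B) (measurableI _ _ mA mB) (@subIsetl _ _ _).
  by left; rewrite mul0e.
by right; rewrite divee ?gt_eqF//; exact: fin_num_measure.
Qed.

Lemma atom_probability_eq0 q A (atomA : is_atom q A) B :
  atom_probability atomA B = 0 <-> q (A `&` B) = 0.
Proof.
have [mA qA0 _] := atomA; rewrite /atom_probability.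
split=> [/eqP|->]; last by rewrite mul0e.
rewrite mule_eq0 inve_eq0 => /orP[/eqP//|/eqP qAy].
by have := probability_le1 q mA; rewrite qAy.
Qed.

Lemma atom_dominated q A (atomA : is_atom q A) :
  atom_probability atomA `<< q.
Proof.
have [mA _ _] := atomA.
apply/null_content_dominatesP => B mB qB0; apply/atom_probability_eq0.
apply: (subset_measure0 _ mB) => //.
exact: measurableI.
Qed.

(** The set [A] plays the part of the support of the density of [p] with respect
    to [q]: the least set, in the sense of [q], that carries [p]. *)
Lemma zero_one_dominated_atom p q : p `<< q -> zero_one p ->
  exists A (atomA : is_atom q A), measure_eq p (atom_probability atomA).
Proof.
move=> /null_content_dominatesP pq p01.
have [A [mA pA1 Amin]] := exists_least_full_set p q.
have pCA0 : p (~` A) = 0 by exact/probability_setC_eq0.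
have qA0 : 0 < q A.
  rewrite lt0e measure_ge0 andbT; apply/eqP => /(pq _ mA)/eqP.
  by rewrite pA1 onee_eq0.
have atomA : is_atom q A.
  split=> // B mB BA; have mAB : measurable (A `\` B) by exact: measurableD.
  have AIB : A `&` B = B by exact/setIidPr.
  have [pB0|pB1] := p01 _ mB; [left|right]; last first.
    by apply/eqP; rewrite eq_le Amin// andbT le_measure ?inE.
  (* [A `\` B] still carries [p], so removing [B] cannot lower the [q]-mass *)
  have : q A <= q (A `\` B).
    apply: Amin => //; rewrite -pA1.
    transitivity (p (A `\` B) + p (A `&` B)); first by rewrite AIB pB0 adde0.
    exact/esym/measureDI.
  rewrite (measureDI q mA mB) AIB leNgt lteDl; last exact: fin_num_measure.
  by rewrite -leNgt measure_le0 => /eqP.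
exists A, atomA; apply: zero_one_dominated_eq; first exact: atom_zero_one.
apply/null_content_dominatesP => B mB /atom_probability_eq0 qAB0.
transitivity (p (B `\` A) + p (A `&` B)).
  by rewrite (setIC A); exact: measureDI.
rewrite (pq (A `&` B))//; last exact: measurableI.
rewrite adde0; apply: (subset_measure0 _ (measurableC mA)) => //.
exact: measurableD.
Qed.

End zero_one.

Theorem proposition3p8 (d : measure_display) (T : measurableType d)
    (R : realType) (q : probability T R) :
  (forall p : probability T R,
     extreme_points (dominated_probabilities q) p <->
     exists (A : set T) (atomA : is_atom q A),
       measure_eq p (atom_probability atomA)) /\
  (atomless q -> extreme_points (dominated_probabilities q) = set0).
Proof.
have extremeP (p : probability T R) :
    extreme_points (dominated_probabilities q) p <->
    exists (A : set T) (atomA : is_atom q A),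
      measure_eq p (atom_probability atomA).
  split=> [pext|[A [atomA pE]]].
    by apply: zero_one_dominated_atom (extreme_zero_one pext); case: pext.
  apply: zero_one_extreme.
    apply/null_content_dominatesP => B mB qB0; rewrite pE//.
    by have /null_content_dominatesP := atom_dominated atomA; apply.
  by move=> B mB; rewrite pE//; exact: atom_zero_one.
split=> // qatomless; apply/seteqP; split=> // p /extremeP[A [atomA _]].
exact: qatomless atomA.
Qed.
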